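(* In the class of bounded distributive lattices, all morphisms are admissible and Max-admissible; that is, for all bounded distributive lattices $L$ and $M$, every bounded lattice morphism $h:L\to M$ is both admissible and Max-admissible.
   Context: Lattices are non-empty; bounded lattice morphisms preserve $0$ and $1$. $\mathrm{Con}(L)$ is the lattice of congruences of $L$ ordered by inclusion, with greatest element $\nabla_L=L^2$. $\mathrm{Max}(L)$ is the set of maximal elements of $\mathrm{Con}(L)\setminus\{\nabla_L\}$. Since the commutator of congruences of a lattice is the intersection, a congruence $\phi\neq\nabla_L$ is prime iff, for all $\alpha,\beta\in \mathrm{Con}(L)$, $\alpha\cap\beta\subseteq\phi$ implies $\alpha\subseteq\phi$ or $\beta\subseteq\phi$; $\mathrm{Spec}(L)$ is the set of prime congruences of $L$. For $\psi\in \mathrm{Con}(M)$, $h^*(\psi)=\{(a,b)\in L^2 : (h(a),h(b))\in\psi\}\in \mathrm{Con}(L)$. The morphism $h:L\to M$ is admissible if $h^*(\psi)\in \mathrm{Spec}(L)$ for all $\psi\in \mathrm{Spec}(M)$, and Max-admissible if $h^*(\psi)\in \mathrm{Max}(L)$ for all $\psi\in \mathrm{Max}(M)$. *)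

(* Defs.v *)
From mathcomp Require Import all_boot all_order.
From mathcomp Require Import boolp classical_sets.

Set Implicit Arguments.
Unset Strict Implicit.
Unset Printing Implicit Defensive.

Local Open Scope classical_set_scope.

Section Congruences.
Context {d : Order.disp_t} {L : latticeType d}.
Implicit Types theta phi : set (L * L).

Record is_congruence theta : Prop := IsCongruence {
  cong_refl : forall a, theta (a, a);
  cong_sym : forall a b, theta (a, b) -> theta (b, a);
  cong_trans : forall a b c, theta (a, b) -> theta (b, c) -> theta (a, c);
  cong_meet : forall a b a' b', theta (a, b) -> theta (a', b') ->
    theta (a `&` a', b `&` b')%O;
  cong_join : forall a b a' b', theta (a, b) -> theta (a', b') ->
    theta (a `|` a', b `|` b')%O }.

End Congruences.

(* Congruences are subsets of L * L, so that the order of Con L is `<=`, its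
   binary meet is `&`, and its greatest element is setT. *)
Definition Con {d : Order.disp_t} (L : latticeType d) : set (set (L * L)) :=
  [set theta | is_congruence theta].
Arguments Con {d} L _.

Definition proper_Con {d : Order.disp_t} (L : latticeType d) :
    set (set (L * L)) :=
  Con L `\ setT.
Arguments proper_Con {d} L _.

Definition Max {d : Order.disp_t} (L : latticeType d) : set (set (L * L)) :=
  [set phi | proper_Con L phi /\
    forall theta, proper_Con L theta -> phi `<=` theta -> theta = phi].
Arguments Max {d} L _.

(* Primality is relative to the commutator of congruences, which for lattices
   is the intersection. *)
Definition Spec {d : Order.disp_t} (L : latticeType d) : set (set (L * L)) :=
  [set phi | proper_Con L phi /\
    forall alpha beta, Con L alpha -> Con L beta ->
      alpha `&` beta `<=` phi -> alpha `<=` phi \/ beta `<=` phi].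
Arguments Spec {d} L _.

Section Morphisms.
Context {d d' : Order.disp_t} {L : latticeType d} {M : latticeType d'}.
(* {lmorphism L -> M} is used, rather than {tblmorphism L -> M}, because the
   latter only requires preservation of \bot and \top. *)
Variable h : {lmorphism L -> M}.

Definition cong_pullback (psi : set (M * M)) : set (L * L) :=
  [set ab | psi (h ab.1, h ab.2)].

Lemma cong_pullback_Con psi : Con M psi -> Con L (cong_pullback psi).
Proof.
case=> rf sm tr mt jn; split=> [a|a b|a b c|a b a' b'|a b a' b'] /=.
- exact: rf.
- exact: sm.
- exact: tr.
- by rewrite /cong_pullback /= !Order.LatticeMorphismTheory.omorphI; apply: mt.
- by rewrite /cong_pullback /= !Order.LatticeMorphismTheory.omorphU; apply: jn.
Qed.

Definition admissible : Prop :=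
  forall psi, Spec M psi -> Spec L (cong_pullback psi).

Definition max_admissible : Prop :=
  forall psi, Max M psi -> Max L (cong_pullback psi).

End Morphisms.

(* Main.v *)
Require Import Defs.
From mathcomp Require Import all_boot all_order.
From mathcomp Require Import boolp classical_sets.

(* In a bounded distributive lattice, the prime congruences and the maximal
   congruences coincide: they are the congruences with exactly two classes, that
   of \bot and that of \top.  This condition mentions only \bot and \top, so it
   is inherited by pullbacks along bounded morphisms.
   To see that a prime or maximal phi relates each a to \bot or \top, consider
   the congruences [x /\ a phi y /\ a] and [x \/ a phi y \/ a]: the first one
   relates a to \top, the second one relates a to \bot, and by distributivity
   their intersection is phi. *)

Import Order.TTheory.
Local Open Scope classical_set_scope.

Definition two_class {d : Order.disp_t} (L : tbLatticeType d)
    (phi : set (L * L)) : Prop :=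
  [/\ Con L phi, ~ phi (\bot%O, \top%O) &
      forall a, phi (a, \bot%O) \/ phi (a, \top%O)].
Arguments two_class {d} L phi.

Section BoundedLattice.
Context {d : Order.disp_t} {L : tbLatticeType d}.
Implicit Types phi theta alpha beta : set (L * L).

Lemma bot_top_cong_setT theta :
  Con L theta -> theta (\bot%O, \top%O) -> theta = setT.
Proof.
move=> [rf sm tr mt jn] t01; apply/seteqP; split=> // -[a b] _.
have at0 x : theta (\bot%O, x).
  by have := mt _ _ _ _ t01 (rf x); rewrite meet0x meet1x.
exact: tr _ _ _ (sm _ _ (at0 a)) (at0 b).
Qed.

Lemma proper_ConP phi :
  proper_Con L phi <-> Con L phi /\ ~ phi (\bot%O, \top%O).
Proof.
split=> [[Cphi phiT]|[Cphi phi01]]; split=> //.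
  by move=> /(bot_top_cong_setT _ Cphi).
by move=> phiT; apply: phi01; rewrite phiT.
Qed.

(** A pair of [alpha] outside [phi] cannot have both entries in the same class of [phi], so one lies
    in the class of [\bot] and the other in that of [\top]; symmetry of [alpha] orients the pair. *)
Lemma two_class_separate phi alpha :
    two_class L phi -> Con L alpha -> ~ alpha `<=` phi ->
  exists u v, [/\ alpha (u, v), phi (u, \bot%O) & phi (v, \top%O)].
Proof.
move=> [[rf sm tr mt jn] phi01 dich] Calpha /existsNP[[x y]] /not_implyP.
move=> [axy nphi].
case: (dich x) (dich y) => [x0|x1] [y0|y1].
- by case: nphi; apply: tr x0 (sm _ _ y0).
- by exists x, y.
- by exists y, x; split=> //; apply: (cong_sym Calpha).
- by case: nphi; apply: tr x1 (sm _ _ y1).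
Qed.

(** A proper [theta] containing [phi] and not contained in it would give the chain [\bot], [u], [v],
    [\top] of [theta]-related elements. *)
Lemma two_class_Max phi : two_class L phi -> Max L phi.
Proof.
move=> tphi; have [Cphi phi01 dich] := tphi; split; first exact/proper_ConP.
move=> theta /proper_ConP[Ctheta theta01] sub; apply/seteqP; split=> //.
apply: contrapT => /(two_class_separate _ _ tphi Ctheta)[u [v [uv u0 v1]]].
have [_ sm tr _ _] := Ctheta; apply: theta01.
exact: tr (sm _ _ (sub _ u0)) (tr _ _ _ uv (sub _ v1)).
Qed.

(** If neither [alpha] nor [beta] lies below [phi], their separated pairs combine into one pair
    [(p, q)] of the intersection, with [p] in the class of [\bot] and [q] in that of [\top]. *)
Lemma two_class_Spec phi : two_class L phi -> Spec L phi.
Proof.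
move=> tphi; have [Cphi phi01 dich] := tphi; split; first exact/proper_ConP.
move=> alpha beta Ca Cb sub.
have [|na] := pselect (alpha `<=` phi); [by left | right].
apply: contrapT => nb.
have [u [v [uv u0 v1]]] := two_class_separate _ _ tphi Ca na.
have [u' [v' [uv' u'0 v'1]]] := two_class_separate _ _ tphi Cb nb.
(* Replacing u by v, or u' by v', makes the join in p absorb q. *)
pose q := (v `&` v')%O; pose p := (q `&` (u `|` u'))%O.
have pq_a : alpha (p, q).
  have := cong_meet Ca (cong_refl Ca q) (cong_join Ca uv (cong_refl Ca u')).
  by rewrite (meet_l (le_trans (leIl _ _ : q <= v)%O (leUl _ _))).
have pq_b : beta (p, q).
  have := cong_meet Cb (cong_refl Cb q) (cong_join Cb (cong_refl Cb u) uv').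
  by rewrite (meet_l (le_trans (leIr _ _ : q <= v')%O (leUr _ _))).
have p0 : phi (p, \bot%O).
  have := cong_meet Cphi (cong_refl Cphi q) (cong_join Cphi u0 u'0).
  by rewrite joinxx meetx0.
have q1 : phi (q, \top%O).
  by have := cong_meet Cphi v1 v'1; rewrite meetxx.
apply: phi01; apply: (cong_trans Cphi) (cong_sym Cphi p0) _.
exact: (cong_trans Cphi) (sub (p, q) (conj pq_a pq_b)) q1.
Qed.

End BoundedLattice.

Section Translations.
Context {d : Order.disp_t} {L : distrLatticeType d}.
Implicit Types (phi : set (L * L)) (a : L).

Definition meet_translate a phi : set (L * L) :=
  [set xy | phi (xy.1 `&` a, xy.2 `&` a)%O].

Definition join_translate a phi : set (L * L) :=
  [set xy | phi (xy.1 `|` a, xy.2 `|` a)%O].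

(** By distributivity, meeting with [a] is a lattice endomorphism, and [meet_translate a phi] is the
    pullback of [phi] along it. *)
Lemma meet_translate_Con a phi : Con L phi -> Con L (meet_translate a phi).
Proof.
move=> [rf sm tr mt jn]; rewrite /meet_translate.
split=> [x|x y|x y z|x y x' y'|x y x' y'] /=;
  [exact: rf|exact: sm|exact: tr|move=> xy xy'|move=> xy xy'].
- by rewrite -(meetxx a) !(meetACA _ _ a a); apply: mt.
- by rewrite !meetUl; apply: jn.
Qed.

Lemma join_translate_Con a phi : Con L phi -> Con L (join_translate a phi).
Proof.
move=> [rf sm tr mt jn]; rewrite /join_translate.
split=> [x|x y|x y z|x y x' y'|x y x' y'] /=;
  [exact: rf|exact: sm|exact: tr|move=> xy xy'|move=> xy xy'].
- by rewrite !joinIl; apply: mt.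
- by rewrite -(joinxx a) !(joinACA _ _ a a); apply: jn.
Qed.

Lemma sub_meet_translate a phi : Con L phi -> phi `<=` meet_translate a phi.
Proof.
by move=> Cphi [x y] xy; apply: (cong_meet Cphi) xy (cong_refl Cphi a).
Qed.

(** This is the cancellation law of distributive lattices modulo [phi]: elements with the same meet
    and the same join with [a] are equal. The chain runs from [x] through [x /\ (y \/ a)] and
    [y /\ (x \/ a)] to [y]. *)
Lemma translateI_sub a phi :
  Con L phi -> meet_translate a phi `&` join_translate a phi `<=` phi.
Proof.
move=> [rf sm tr mt jn] [x y] [/= xy_meet xy_join].
have x_mid : phi (x, (x `&` y) `|` (x `&` a))%O.
  by have := mt _ _ _ _ (rf x) xy_join; rewrite joinKI meetUr.
have mid : phi ((x `&` y) `|` (x `&` a), y `&` (x `|` a))%O.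
  by rewrite meetUr (meetC y x); apply: jn (rf _) xy_meet.
have mid_y : phi (y `&` (x `|` a), y)%O.
  by have := mt _ _ _ _ (rf y) xy_join; rewrite joinKI.
exact: tr x_mid (tr _ _ _ mid mid_y).
Qed.

End Translations.

Section BoundedDistrLattice.
Context {d : Order.disp_t} {L : tbDistrLatticeType d}.
Implicit Type phi : set (L * L).

Lemma Spec_two_class phi : Spec L phi -> two_class L phi.
Proof.
move=> [/proper_ConP[Cphi phi01] prime]; split=> // a.
have [sub|sub] := prime _ _ (meet_translate_Con a _ Cphi)
  (join_translate_Con a _ Cphi) (translateI_sub a _ Cphi).
- right; apply: sub; rewrite /meet_translate /= meetxx meet1x.
  exact: (cong_refl Cphi).
- left; apply: sub; rewrite /join_translate /= joinxx join0x.
  exact: (cong_refl Cphi).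
Qed.

(** The congruence [meet_translate a phi] contains [phi], so it is improper, which relates [a] to
    [\bot], or equal to [phi], which relates [a] to [\top]. *)
Lemma Max_two_class phi : Max L phi -> two_class L phi.
Proof.
move=> [/proper_ConP[Cphi phi01] maxphi]; split=> // a.
have Ca := meet_translate_Con a _ Cphi.
have [a0|na0] := pselect (meet_translate a phi (\bot%O, \top%O)).
  left; apply: (cong_sym Cphi).
  by move: a0; rewrite /meet_translate /= meet0x meet1x.
right; rewrite -(maxphi (meet_translate a phi)).
- by rewrite /meet_translate /= meetxx meet1x; apply: (cong_refl Cphi).
- exact/proper_ConP.
- exact: sub_meet_translate.
Qed.

End BoundedDistrLattice.

Lemma two_class_pullback (d d' : Order.disp_t)
    (L : tbLatticeType d) (M : tbLatticeType d') (h : {lmorphism L -> M})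
    (psi : set (M * M)) :
    h \bot%O = \bot%O -> h \top%O = \top%O ->
  two_class M psi -> two_class L (cong_pullback h psi).
Proof.
move=> h0 h1 [Cpsi psi01 dich]; split; first exact: cong_pullback_Con.
  by rewrite /cong_pullback /= h0 h1.
by move=> a; rewrite /cong_pullback /= h0 h1; apply: dich.
Qed.

Theorem proposition7p5 (d d' : Order.disp_t)
    (L : tbDistrLatticeType d) (M : tbDistrLatticeType d')
    (h : {lmorphism L -> M})
    (h0 : h \bot%O = \bot%O) (h1 : h \top%O = \top%O) :
  admissible h /\ max_admissible h.
Proof.
split=> psi.
- by move=> /Spec_two_class/(two_class_pullback _ _ _ _ _ _ h0 h1)/two_class_Spec.
- by move=> /Max_two_class/(two_class_pullback _ _ _ _ _ _ h0 h1)/two_class_Max.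
Qed.
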